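(* Let $A$ be a $d$-dimensional $k$-stochastic matrix of order $n$ and let $S\subseteq\{1,\ldots,d\}$ with $|S|=\ell$. If $k+\ell\le d$, then $\frac{1}{n}A_S$, where $A_S$ is the $S$-contraction of $A$, is a $(d-\ell)$-dimensional $k$-stochastic matrix of order $n$.
   Context: Let $I_n^d = \{1,\ldots,n\}^d$. A $d$-dimensional matrix $A$ of order $n$ is an array $(a_\alpha)_{\alpha\in I_n^d}$ of real numbers (a $0$-dimensional matrix is a single number). For $k\in\{0,\ldots,d\}$, a $k$-dimensional plane in $A$ is a submatrix obtained by fixing some $d-k$ components of the indices and letting the other $k$ components vary from $1$ to $n$. For $k\in\{0,\ldots,d\}$, $A$ is $k$-stochastic if all its entries are nonnegative and the sum of entries in each $k$-dimensional plane equals $1$. For a $d$-dimensional matrix $A$ of order $n$ and $S\subseteq\{1,\ldots,d\}$, $|S|=\ell$, the $S$-contraction $A_S$ is the $(d-\ell)$-dimensional matrix of order $n$ whose entry at $\beta\in I_n^{d-\ell}$ is $\sum_{i=1}^n a_{\alpha(i,\beta)}$, where $\alpha(i,\beta)\in I_n^d$ is the index that has the value $i$ at all positions in $S$ and the components of $\beta$, in order, at the remaining positions. *)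

(* Defs.v *)
From mathcomp Require Import all_boot all_order all_algebra reals.

Set Implicit Arguments.
Unset Strict Implicit.
Unset Printing Implicit Defensive.

Import GRing.Theory Num.Theory.
Local Open Scope ring_scope.

(* R^o rather than R, so that multidimensional matrices can be scaled by *:. *)
Definition mdmatrix (R : realType) (d n : nat) := {ffun d.-tuple 'I_n -> R^o}.

(* The indices of the #|K|-dimensional plane through g: the components in K
   vary, the other ones are fixed to those of g. When 0 < n every choice of
   fixed components extends to such a g. *)
Definition plane (d n : nat) (K : {set 'I_d}) (g : d.-tuple 'I_n) :
    {set d.-tuple 'I_n} :=
  [set a | [forall j in ~: K, tnth a j == tnth g j]].

Definition kstochastic (R : realType) (d n k : nat) (A : mdmatrix R d n) : Prop :=
  [/\ (k <= d)%N,
      forall a, 0 <= A a :> R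
    & forall (K : {set 'I_d}) (g : d.-tuple 'I_n), #|K| = k ->
        \sum_(a in plane K g) A a = 1 :> R].

(* A position j outside S receives the component of b whose rank is the number
   of positions outside S that precede j; this rank is less than d - #|S|, so
   the default value i of nth is not used. *)
Definition extend_index (d n : nat) (S : {set 'I_d}) (i : 'I_n)
    (b : (d - #|S|).-tuple 'I_n) : d.-tuple 'I_n :=
  [tuple if j \in S then i else nth i b #|[set q in ~: S | (q < j)%N]| | j < d].

Definition contraction (R : realType) (d n : nat) (A : mdmatrix R d n)
    (S : {set 'I_d}) : mdmatrix R (d - #|S|) n :=
  [ffun b => \sum_(i < n) A (extend_index (S := S) i b)].

(* Main.v *)
Require Import Defs.
From mathcomp Require Import all_boot all_order all_algebra reals.

Import GRing.Theory Num.Theory.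
Local Open Scope ring_scope.

(** For each fixed value i on the positions of S, the entries
    A (extend_index i b), with b running through a k-dimensional plane of the
    contraction, are exactly the entries of A on one k-dimensional plane of A:
    the positions in S are fixed to i, and the positions outside S are fixed or
    free as prescribed by the plane of b ([plane_extend_index]). Hence they sum
    to 1. Summing over the n values of i, each k-dimensional plane of the
    contraction has sum n, and the factor 1/n normalises it.

    What has to be made precise is the order-preserving numbering of the
    positions outside S by 0, ..., d - #|S| - 1. The rank of a position, the
    number of positions outside S that precede it, is injective outside S and
    takes values below #|~: S| = d - #|S|; by counting it is therefore a
    bijection, and its inverse phi embeds the positions of the contraction into
    those of A ([complement_embedding]). *)

Definition rank_outside {d : nat} (S : {set 'I_d}) (j : 'I_d) : nat :=
  #|[set q in ~: S | (q < j)%N]|.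

Lemma rank_outside_lt {d : nat} {S : {set 'I_d}} {j : 'I_d} :
  j \notin S -> (rank_outside S j < d - #|S|)%N.
Proof.
move=> jS; have <- : #|~: S| = (d - #|S|)%N by rewrite cardsCs setCK card_ord.
apply/proper_card/properP; split.
  by apply/subsetP => q; rewrite inE => /andP[].
by exists j; rewrite !inE ?jS // ltnn andbF.
Qed.

Lemma rank_outside_mono {d : nat} {S : {set 'I_d}} {j j' : 'I_d} :
  j \notin S -> (j < j')%N -> (rank_outside S j < rank_outside S j')%N.
Proof.
move=> jS ltjj'; apply/proper_card/properP; split.
  apply/subsetP => q; rewrite !inE => /andP[-> /= ltqj].
  exact: ltn_trans ltqj ltjj'.
by exists j; rewrite !inE ?jS ?ltjj' // ltnn andbF.
Qed.

Lemma rank_outside_inj {d : nat} {S : {set 'I_d}} :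
  {in ~: S &, injective (rank_outside S)}.
Proof.
move=> j j'; rewrite !inE => jS j'S eq_rank; apply: val_inj => /=.
case: (ltngtP j j') => // lt.
  by have := rank_outside_mono jS lt; rewrite eq_rank ltnn.
by have := rank_outside_mono j'S lt; rewrite eq_rank ltnn.
Qed.

(** An injection between finite sets of the same cardinality, here ~: S and
    the ordinals below d - #|S|, is onto. *)
Lemma rank_outside_surj {d : nat} (S : {set 'I_d}) (r : 'I_(d - #|S|)) :
  exists j, j \notin S /\ rank_outside S j = r.
Proof.
(* The default value r of insubd is never taken on ~: S. *)
pose f (j : 'I_d) : 'I_(d - #|S|) := insubd r (rank_outside S j).
have fE j : j \notin S -> f j = rank_outside S j :> nat.
  by move=> jS; rewrite val_insubd rank_outside_lt.
have f_inj : {in ~: S &, injective f}.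
  move=> j j' jS j'S eq_f; apply: (rank_outside_inj _ _ jS j'S).
  by rewrite -!fE ?eq_f // -in_setC.
have f_onto : f @: (~: S) = setT.
  apply/eqP; rewrite eqEcard subsetT /= card_in_imset // cardsT card_ord.
  by rewrite [#|~: S|]cardsCs setCK card_ord.
have : r \in f @: (~: S) by rewrite f_onto.
case/imsetP => j; rewrite inE => jS ->.
by exists j; rewrite fE.
Qed.

(** Here phi is the inverse of the rank. These properties of phi are all that
    is needed about [extend_index] outside S, so that the counting formula in
    its definition does not enter the study of planes. *)
Lemma complement_embedding (d n : nat) (S : {set 'I_d}) :
  exists phi : 'I_(d - #|S|) -> 'I_d,
    [/\ injective phi,
        forall r, phi r \notin S,
        forall j, j \notin S -> exists r, j = phi r
      & forall (i : 'I_n) (b : (d - #|S|).-tuple 'I_n) r,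
          tnth (extend_index (S := S) i b) (phi r) = tnth b r].
Proof.
have [phi phiP] := fin_all_exists (rank_outside_surj S).
have phiS r : phi r \notin S by case: (phiP r).
have phiK r : rank_outside S (phi r) = r by case: (phiP r).
exists phi; split => //.
- by move=> r r' eq_phi; apply: val_inj; rewrite /= -!phiK eq_phi.
- move=> j jS; exists (Ordinal (rank_outside_lt jS)).
  by apply: (@rank_outside_inj _ S); rewrite ?inE ?phiK.
- move=> i b r; rewrite tnth_mktuple (negPf (phiS r)).
  by rewrite -/(rank_outside S (phi r)) phiK -tnth_nth.
Qed.

Lemma tnth_extend_index_in (d n : nat) (S : {set 'I_d}) (i : 'I_n)
    (b : (d - #|S|).-tuple 'I_n) (j : 'I_d) :
  j \in S -> tnth (extend_index (S := S) i b) j = i.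
Proof. by move=> jS; rewrite tnth_mktuple jS. Qed.

Lemma extend_index_inj (d n : nat) (S : {set 'I_d}) (i : 'I_n) :
  injective (@extend_index d n S i).
Proof.
have [phi [_ _ _ phiE]] := complement_embedding d n S.
by move=> b b' eq_ext; apply: eq_from_tnth => r; rewrite -!(phiE i) eq_ext.
Qed.

(** The free positions K' are the image of K under the numbering of the
    positions outside S. No position of S is free, so all indices of the plane
    through [extend_index i g] share the value i on S and are themselves
    extensions by i. *)
Lemma plane_extend_index {d : nat} (n : nat) {S : {set 'I_d}}
    (K : {set 'I_(d - #|S|)}) :
  exists2 K' : {set 'I_d}, #|K'| = #|K|
    & forall (i : 'I_n) g,
        plane K' (extend_index (S := S) i g) =
        extend_index (S := S) i @: plane K g.
Proof.
have [phi [phi_inj phiS phi_onto phiE]] := complement_embedding d n S.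
exists (phi @: K) => [|i g]; first exact: card_imset.
apply/setP => a; apply/idP/imsetP => [|[b b_plane ->]].
- rewrite inE => /forall_inP a_plane.
  (* The preimage of a is read off at the positions outside S. *)
  exists [tuple tnth a (phi r) | r < d - #|S|].
    rewrite inE; apply/forall_inP => r; rewrite inE => rK.
    rewrite tnth_mktuple -(phiE i); apply: a_plane.
    by rewrite inE mem_imset.
  apply: eq_from_tnth => j; have [jS|jS] := boolP (j \in S).
    (* The positions in S are not free, so there a agrees with the base point
       of the plane and has the value i. *)
    have jK : j \in ~: (phi @: K).
      rewrite inE; apply/imsetP => -[r _ def_j].
      by have := phiS r; rewrite -def_j jS.
    by rewrite (eqP (a_plane j jK)) !tnth_extend_index_in.
  by have [r ->] := phi_onto j jS; rewrite phiE tnth_mktuple.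
- move: b_plane; rewrite !inE => /forall_inP b_plane.
  apply/forall_inP => j; have [jS _|jS] := boolP (j \in S).
    by rewrite !tnth_extend_index_in.
  have [r ->] := phi_onto j jS.
  by rewrite inE mem_imset // !phiE => rK; apply: b_plane; rewrite inE.
Qed.

(** Each of the n values on S contributes a full k-dimensional plane of A. *)
Lemma sum_plane_contraction {R : realType} {d n k : nat} {A : mdmatrix R d n}
    {S : {set 'I_d}} {K : {set 'I_(d - #|S|)}} (g : (d - #|S|).-tuple 'I_n) :
  kstochastic k A -> #|K| = k ->
  \sum_(b in plane K g) contraction A S b = n%:R :> R.
Proof.
move=> [_ _ A_plane] cardK.
have [K' cardK' planeE] := plane_extend_index n K.
under eq_bigr do rewrite ffunE.
rewrite exchange_big /=.
have plane_sum (i : 'I_n) :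
    \sum_(b in plane K g) A (extend_index (S := S) i b) = 1 :> R.
  rewrite -(A_plane K' (extend_index (S := S) i g)) ?cardK' //.
  rewrite planeE big_imset //=.
  by move=> b b' _ _; apply: extend_index_inj.
under eq_bigr do rewrite plane_sum.
by rewrite sumr_const card_ord.
Qed.

Theorem theorem3 (R : realType) (d n k l : nat) (A : mdmatrix R d n)
    (S : {set 'I_d}) (n_gt0 : (0 < n)%N) (cardS : #|S| = l)
    (A_stoch : kstochastic k A) (le_kl_d : (k + l <= d)%N) :
  kstochastic k (n%:R^-1 *: contraction A S).
Proof.
have [_ A_ge0 _] := A_stoch; split.
- by rewrite cardS leq_subRL ?(leq_trans (leq_addl k l)) // addnC.
- move=> b; rewrite !ffunE; apply: mulr_ge0; first by rewrite invr_ge0 ler0n.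
  by apply: sumr_ge0 => i _; apply: A_ge0.
- move=> K g cardK; under eq_bigr do rewrite ffunE.
  rewrite -scaler_sumr (sum_plane_contraction g A_stoch cardK).
  by apply: mulVf; rewrite pnatr_eq0 -lt0n.
Qed.
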